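(* Let $R$ be a (two-sided) perfect ring and let $T$ be a sincere silting left $R$-module (i.e., $T$ is both sincere and silting) of finite projective dimension. Then $T$ is a tilting module if and only if $\mathrm{Ext}^{i}_{R}(T,T^{(J)})=0$ for every set $J$ and every integer $i\geqslant 1$.
   Context: A ring $R$ is left (resp. right) perfect if every left (resp. right) $R$-module has a projective cover, and perfect if it is both. Modules are left $R$-modules, not necessarily finitely generated. $T^{(J)}$ denotes the direct sum of $J$ copies of $T$. $\mathrm{Add}\,T$ is the class of modules isomorphic to direct summands of (arbitrary) direct sums of copies of $T$; $\mathrm{Gen}\,T$ is the class of all epimorphic images of modules in $\mathrm{Add}\,T$. $T$ is sincere if $\mathrm{Hom}_R(P,T)\neq 0$ for every non-zero projective module $P$. For a morphism $\sigma$ of modules, $D_\sigma$ is the class of all modules $X$ such that the map $\mathrm{Hom}_R(\sigma,X)$ is surjective. A projective presentation of $T$ is a morphism $\sigma:P_1\to P_0$ between projective modules fitting in an exact sequence $P_1\xrightarrow{\sigma}P_0\to T\to 0$. $T$ is silting if there is a projective presentation $\sigma$ of $T$ with $\mathrm{Gen}\,T=D_\sigma$. $T$ is tilting if $\mathrm{Gen}\,T=\{M\mid \mathrm{Ext}^1_R(T,M)=0\}$; equivalently, if (T1) $T$ has projective dimension at most one, (T2) $\mathrm{Ext}^1_R(T,T^{(J)})=0$ for every set $J$, and (T3) there is an exact sequence $0\to R\to T_0\to T_1\to 0$ with $T_0,T_1\in\mathrm{Add}\,T$. *)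

(* Defs.v *)
From HB Require Import structures.
From mathcomp Require Import all_boot ssralg.
From mathcomp Require Import boolp classical_sets functions cardinality.

Set Implicit Arguments.
Unset Strict Implicit.
Unset Printing Implicit Defensive.

Import GRing.Theory.

Local Open Scope ring_scope.

(* T^(J), as the submodule of finitely supported families of the product
   J -> T. *)
Section DirectSum.
Variables (R : pzRingType) (T : lmodType R) (J : Type).

Definition finitely_supported : {pred J -> T} :=
  fun f => `[< finite_set [set j | f j <> 0]%classic >].

Lemma finitely_supported_submod : subsemimod_closed finitely_supported.
Proof.
split; last first.
  move=> a f /asboolP ff; apply/asboolP; apply: sub_finite_set ff => j /= h fj0.
  by apply: h; rewrite /GRing.scale /= fj0 scaler0.
split.
  apply/asboolP; rewrite (_ : mkset _ = set0) //.
  by apply/seteqP; split => // j /=.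
move=> f g /asboolP ff /asboolP fg; apply/asboolP.
have h : finite_set ([set j | f j <> 0] `|` [set j | g j <> 0])%classic.
  by rewrite finite_setU.
apply: sub_finite_set h => j /= fgj.
have [fj0|] := pselect (f j = 0); last by left.
by right => gj0; apply: fgj; rewrite /GRing.add /= fj0 gj0 addr0.
Qed.

HB.instance Definition _ :=
  GRing.isSubSemiModClosed.Build R (J -> T) finitely_supported
    finitely_supported_submod.

Record direct_sum : Type := DirectSum {
  family_of :> J -> T;
  _ : family_of \in finitely_supported
}.

HB.instance Definition _ := [isSub for family_of].
HB.instance Definition _ := [Choice of direct_sum by <:].
HB.instance Definition _ := [SubChoice_isSubLmodule of direct_sum by <:].

End DirectSum.

Section Modules.
Variable R : pzRingType.
Implicit Types A B M N P T U V W X : lmodType R.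

Definition is_surjective U V (f : U -> V) : Prop := forall y, exists x, f x = y.

Definition exact_at U V W (f : U -> V) (g : V -> W) : Prop :=
  forall y, g y = 0 <-> exists x, f x = y.

Definition zero_module M : Prop := forall x : M, x = 0.

Definition projective P : Prop :=
  forall A B (g : {linear A -> B}) (f : {linear P -> B}),
    is_surjective g -> exists h : {linear P -> A}, forall x, g (h x) = f x.

(* With boolp, boolean predicates N cover all submodules of M. *)
Definition superfluous M (K : {pred M}) : Prop :=
  forall N : {pred M}, submod_closed N ->
    (forall x, exists y z, [/\ y \in N, z \in K & x = y + z]) ->
    forall x, x \in N.

Definition projective_cover M P (p : {linear P -> M}) : Prop :=
  [/\ projective P, is_surjective p & superfluous [pred x | p x == 0]].

Definition in_Add T M : Prop :=
  exists (J : Type) N (f : {linear (M * N)%type -> direct_sum T J}),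
    bijective f.

Definition in_Gen T M : Prop :=
  exists A, in_Add T A /\ exists f : {linear A -> M}, is_surjective f.

Definition sincere T : Prop :=
  forall P, projective P -> ~ zero_module P ->
    exists (f : {linear P -> T}) (x : P), f x <> 0.

Definition in_D P1 P0 (sigma : {linear P1 -> P0}) X : Prop :=
  forall f : {linear P1 -> X},
    exists g : {linear P0 -> X}, forall x, g (sigma x) = f x.

Definition projective_presentation T P1 P0 (sigma : {linear P1 -> P0}) : Prop :=
  [/\ projective P1, projective P0 &
      exists p : {linear P0 -> T}, is_surjective p /\ exact_at sigma p].

Definition silting T : Prop :=
  exists P1 P0 (sigma : {linear P1 -> P0}),
    projective_presentation T sigma /\
    forall M, in_Gen T M <-> in_D sigma M.

(* ... -> res_obj 2 -> res_obj 1 -> res_obj 0 -> A -> 0, where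
   res_diff n : res_obj n.+1 -> res_obj n. *)
Record projective_resolution (A : lmodType R) : Type := ProjectiveResolution {
  res_obj : nat -> lmodType R;
  res_diff : forall n, {linear res_obj n.+1 -> res_obj n};
  res_aug : {linear res_obj 0%N -> A};
  res_projective : forall n, projective (res_obj n);
  res_aug_surj : is_surjective res_aug;
  res_exact_aug : exact_at (res_diff 0%N) res_aug;
  res_exact : forall n, exact_at (res_diff n.+1) (res_diff n)
}.

Definition cocycle A (P : projective_resolution A) M n
    (f : {linear res_obj P n -> M}) : Prop :=
  forall x, f (res_diff P n x) = 0.

Definition coboundary A (P : projective_resolution A) M n :
    {linear res_obj P n -> M} -> Prop :=
  match n with
  | 0 => fun f => forall x, f x = 0
  | m.+1 => fun f =>
      exists g : {linear res_obj P m -> M}, forall x, f x = g (res_diff P m x)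
  end.

(* Ext^n_R(A, M) = 0, i.e. H^n(Hom_R(P, M)) = 0 for a projective resolution P
   of A; the cohomology does not depend on P, so all P are allowed. *)
Definition Ext_eq0 (n : nat) A M : Prop :=
  forall (P : projective_resolution A) (f : {linear res_obj P n -> M}),
    cocycle f -> coboundary f.

Definition projdim_le (n : nat) A : Prop :=
  exists P : projective_resolution A,
    forall k, (n < k)%N -> zero_module (res_obj P k).

Definition finite_projdim A : Prop := exists n, projdim_le n A.

Definition tilting T : Prop := forall M, in_Gen T M <-> Ext_eq0 1 T M.

End Modules.

Definition left_perfect (R : pzRingType) : Prop :=
  forall M : lmodType R,
    exists (P : lmodType R) (p : {linear P -> M}), projective_cover p.

(* Right R-modules are left modules over the converse ring. *)
Definition right_perfect (R : pzRingType) : Prop := left_perfect R^c.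

Definition perfect (R : pzRingType) : Prop := left_perfect R /\ right_perfect R.

(* Main.v *)
Require Import Defs.
From HB Require Import structures.
From mathcomp Require Import all_boot ssralg.
From mathcomp Require Import generic_quotient.
From mathcomp Require Import boolp classical_sets functions cardinality fsbigop.

(** Write sigma : P1 -> P0 for the presentation with Gen T = D_sigma.  In both
    directions the point is that sigma is injective; once it is, every map
    from P1 is a cocycle, so D_sigma is the class of all M with
    Ext^1(T, M) = 0 (in_D_Ext1), and pd T <= 1.  Since R is left perfect,
    sigma extends to a resolution Q of T in which each Q_(n+2) is a projective
    cover of ker d_n (minimal_resolution), and Ext may be computed on Q
    (Ext_eq0_resolution).

    Suppose Ext^i(T, T^(J)) = 0 for all i >= 1.  Every M in Gen T has a
    resolution 0 -> L -> T^(J) -> M -> 0 with L again in Gen T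
    (Gen_resolve), so Ext^i(T, M) = Ext^(i+1)(T, L), and finite projective
    dimension gives Ext^i(T, M) = 0 for all i >= 1 (Ext_Gen_eq0).  For i = 2
    this forces Q_2 = 0 (resolution_term2_zero).  Otherwise sincerity gives a
    nonzero f : Q_2 -> T; put M = T / f(ker d_1).  The induced map Q_2 -> M is
    a cocycle, hence factors through d_1, and the factor Q_1 -> M itself
    factors through d_0 as M is in D_sigma.  So the induced map is zero, i.e.
    f(Q_2) = f(ker d_1); as ker d_1 is superfluous in Q_2, f = 0, a
    contradiction.

    Suppose T is tilting.  Bongartz's construction embeds Q_1 in a module E
    with Ext^1(T, E) = 0 (Ext1_orthogonal_embedding).  Then E is in
    Gen T = D_sigma, so the embedding factors through sigma, which is therefore
    injective.  By minimality Q_n = 0 for n >= 2 (minimal_zero), so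
    Ext^i(T, -) = 0 for i >= 2. *)

Set Implicit Arguments.
Unset Strict Implicit.
Unset Printing Implicit Defensive.

Import GRing.Theory.
Local Open Scope ring_scope.

(** * Linear maps, kernels and cokernels *)

Section Linear.
Variable R : pzRingType.
Implicit Types U V W : lmodType R.

Lemma linear_exists U V (h : U -> V) :
  (forall a u v, h (a *: u + v) = a *: h u + h v) ->
  exists k : {linear U -> V}, forall x, k x = h x.
Proof.
move=> h_lin; pose k := HB.pack_for {linear U -> V} h
  (GRing.isLinear.Build R U V *:%R h h_lin).
by exists k.
Qed.

Lemma linear_pair U V W (f : {linear U -> V}) (g : {linear U -> W}) :
  exists h : {linear U -> (V * W)%type}, forall x, h x = (f x, g x).
Proof.
by apply: linear_exists => a u v; apply/pair_equal_spec; split; exact: linearP.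
Qed.

End Linear.

Section Kernel.
Variables (R : pzRingType) (U V : lmodType R) (f : {linear U -> V}).

Definition ker_pred : {pred U} := fun x => f x == 0.

Lemma ker_pred_submod : subsemimod_closed ker_pred.
Proof.
split=> [|a x /eqP fx0]; last by rewrite unfold_in linearZ /= fx0 scaler0.
split=> [|x y /eqP fx0 /eqP fy0]; rewrite unfold_in ?linear0 //.
by rewrite linearD fx0 fy0 addr0.
Qed.

HB.instance Definition _ :=
  GRing.isSubSemiModClosed.Build R U ker_pred ker_pred_submod.

Record kernel : Type := Kernel { ker_val : U; _ : ker_val \in ker_pred }.

HB.instance Definition _ := [isSub for ker_val].
HB.instance Definition _ := [Choice of kernel by <:].
HB.instance Definition _ := [SubChoice_isSubLmodule of kernel by <:].

End Kernel.

Lemma kernel_exists (R : pzRingType) (U V : lmodType R) (f : {linear U -> V}) :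
  exists (K : lmodType R) (i : {linear K -> U}),
    injective i /\ exact_at i f.
Proof.
exists (kernel f).
have [i iE] : exists i : {linear kernel f -> U}, forall x, i x = val x.
  by apply: linear_exists.
exists i; split=> [x y|y]; first by rewrite !iE => /val_inj.
split=> [fy0|[x <-]]; last by rewrite iE; apply/eqP; exact: (valP x).
have fy : y \in ker_pred f by apply/eqP.
by exists (Kernel fy); rewrite iE.
Qed.

Section Cokernel.
Variables (R : pzRingType) (U V : lmodType R) (f : {linear U -> V}).

Definition coker_rel (x y : V) : bool := `[< exists u, f u = x - y >].

Lemma coker_relP : equiv_class_of coker_rel.
Proof.
split=> [x|x y|y x z].
- by apply/asboolP; exists 0; rewrite linear0 subrr.
- by apply/asboolP/asboolP=> -[u fu]; exists (- u); rewrite linearN fu opprB.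
- move=> /asboolP[u fu] /asboolP[v fv]; apply/asboolP; exists (u + v).
  by rewrite linearD fu fv addrA subrK.
Qed.

Canonical coker_equiv := EquivRelPack coker_relP.
Definition cokernel : Type := {eq_quot coker_equiv}%qT.
HB.instance Definition _ := Choice.on cokernel.
HB.instance Definition _ := Quotient.on cokernel.

Local Notation pi := (\pi_(cokernel))%qT.

Lemma coker_ind (P : cokernel -> Prop) : (forall x, P (pi x)) -> forall c, P c.
Proof. by move=> P_pi c; rewrite -[c]reprK. Qed.

Lemma coker_piP (x y : V) : pi x = pi y <-> exists u, f u = x - y.
Proof. by split=> [/eqmodP/asboolP|h]; last by apply/eqmodP/asboolP. Qed.

Lemma coker_reprK (x : V) : exists u, f u = repr (pi x) - x.
Proof. by apply/coker_piP; rewrite reprK. Qed.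

Definition coker_add (x y : cokernel) : cokernel := pi (repr x + repr y).
Definition coker_opp (x : cokernel) : cokernel := pi (- repr x).
Definition coker_scale (a : R) (x : cokernel) : cokernel := pi (a *: repr x).

Lemma coker_piD x y : coker_add (pi x) (pi y) = pi (x + y).
Proof.
apply/coker_piP; have [u fu] := coker_reprK x; have [v fv] := coker_reprK y.
by exists (u + v); rewrite linearD fu fv opprD addrACA.
Qed.

Lemma coker_piN x : coker_opp (pi x) = pi (- x).
Proof.
apply/coker_piP; have [u fu] := coker_reprK x.
by exists (- u); rewrite linearN fu opprD.
Qed.

Lemma coker_piZ a x : coker_scale a (pi x) = pi (a *: x).
Proof.
apply/coker_piP; have [u fu] := coker_reprK x.
by exists (a *: u); rewrite linearZ /= fu scalerBr.
Qed.

Lemma coker_addA : associative coker_add.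
Proof.
move=> x y z; elim/coker_ind: x => x; elim/coker_ind: y => y.
by elim/coker_ind: z => z; rewrite !coker_piD addrA.
Qed.

Lemma coker_addC : commutative coker_add.
Proof.
move=> x y; elim/coker_ind: x => x; elim/coker_ind: y => y.
by rewrite !coker_piD addrC.
Qed.

Lemma coker_add0 : left_id (pi 0) coker_add.
Proof. by move=> x; elim/coker_ind: x => x; rewrite coker_piD add0r. Qed.

Lemma coker_addN : left_inverse (pi 0) coker_opp coker_add.
Proof.
by move=> x; elim/coker_ind: x => x; rewrite coker_piN coker_piD addNr.
Qed.

HB.instance Definition _ := GRing.isZmodule.Build cokernel
  coker_addA coker_addC coker_add0 coker_addN.

Lemma coker_scaleA a b x :
  coker_scale a (coker_scale b x) = coker_scale (a * b) x.
Proof. by elim/coker_ind: x => x; rewrite !coker_piZ scalerA. Qed.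

Lemma coker_scale1 : left_id 1 coker_scale.
Proof. by move=> x; elim/coker_ind: x => x; rewrite coker_piZ scale1r. Qed.

Lemma coker_scaleDr : right_distributive coker_scale +%R.
Proof.
move=> a x y; elim/coker_ind: x => x; elim/coker_ind: y => y.
rewrite [pi x + pi y]coker_piD !coker_piZ scalerDr.
by rewrite [RHS]coker_piD.
Qed.

Lemma coker_scaleDl x : {morph coker_scale^~ x : a b / a + b}.
Proof.
move=> a b; elim/coker_ind: x => x.
by rewrite !coker_piZ [RHS]coker_piD scalerDl.
Qed.

HB.instance Definition _ := GRing.Zmodule_isLmodule.Build R cokernel
  coker_scaleA coker_scale1 coker_scaleDr coker_scaleDl.

End Cokernel.

Lemma cokernel_exists (R : pzRingType) (U V : lmodType R)
    (f : {linear U -> V}) :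
  exists (C : lmodType R) (q : {linear V -> C}),
    is_surjective q /\ exact_at f q.
Proof.
exists (cokernel f).
have [q qE] : exists q : {linear V -> cokernel f},
    forall x, q x = (\pi_(cokernel f) x)%qT.
  by apply: linear_exists => a u v; rewrite -coker_piD -coker_piZ.
exists q; split=> [y|y]; first by exists (repr y); rewrite qE reprK.
rewrite qE; split=> [/coker_piP[u fu]|[u fu]].
  by exists u; rewrite fu subr0.
by apply/coker_piP; exists u; rewrite fu subr0.
Qed.

(** * Direct sums *)

Section DirectSum.
Variables (R : pzRingType) (T : lmodType R) (J : Type).
Local Notation S := (direct_sum T J).
Implicit Type M : lmodType R.

Lemma ds_eqP (x y : S) : (forall j, x j = y j) -> x = y.
Proof. by move=> xy; apply/val_inj/funext. Qed.

Lemma ds_linE a (x y : S) j : (a *: x + y) j = a *: x j + y j.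
Proof. by []. Qed.

Lemma ds_build (g : J -> T) : finite_set [set j | g j <> 0]%classic ->
  exists x : S, forall j, x j = g j.
Proof.
move=> g_fin; have gP : g \in @finitely_supported R T J by apply/asboolP.
by exists (DirectSum gP).
Qed.

Lemma ds_support (x : S) : exists s : seq {classic J},
  uniq s /\ forall j : {classic J}, x j <> 0 -> j \in s.
Proof.
have x_fin : finite_set [set j : {classic J} | x j <> 0]%classic.
  by case: x => x /= /asboolP.
have [s sE] := (finite_seqP _).1 x_fin.
exists (undup s); split=> [|j xj]; first exact: undup_uniq.
by rewrite mem_undup; have : [set` s]%classic j by rewrite -sE.
Qed.

Lemma ds_incl_exists : exists i : J -> {linear T -> S},
  (forall j t, i j t j = t) /\ (forall j k t, k <> j -> i j t k = 0).
Proof.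
suff /choice[i iP] : forall j, exists i : {linear T -> S},
    (forall t, i t j = t) /\ (forall k t, k <> j -> i t k = 0).
  exists i; split=> [j t|j k t kj]; first by case: (iP j).
  by case: (iP j) => _; apply.
move=> j.
have /choice[i iE] : forall t, exists x : S, forall k,
    x k = if pselect (k = j) then t else 0.
  move=> t; apply: (@ds_build (fun k => if pselect (k = j) then t else 0)).
  by apply: (sub_finite_set _ (finite_set1 j)) => k /=; case: pselect.
have [k kE] : exists k : {linear T -> S}, forall t, k t = i t.
  apply: linear_exists => a u v; apply: ds_eqP => k.
  rewrite ds_linE !iE.
  by case: (pselect (k = j)) => //= kj; rewrite scaler0 addr0.
exists k; split=> [t|l t lj]; rewrite kE iE.
  by case: pselect.
by case: pselect.
Qed.

Definition ds_incl : J -> {linear T -> S} := projT1 (cid ds_incl_exists).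

Lemma ds_incl_id j t : ds_incl j t j = t.
Proof. by rewrite /ds_incl; case: cid => i /= []. Qed.

Lemma ds_incl_neq j k t : k <> j -> ds_incl j t k = 0.
Proof. by rewrite /ds_incl; case: cid => i /= [_]; apply. Qed.

Lemma ds_proj_exists j : exists p : {linear S -> T}, forall x, p x = x j.
Proof. exact: linear_exists. Qed.

(** Any list s containing the support may be used, so that two elements can be
    expanded along a common list. *)
Lemma ds_sum (x : S) (s : seq {classic J}) : uniq s ->
  (forall j : {classic J}, x j <> 0 -> j \in s) ->
  x = \sum_(j <- s) ds_incl j (x j).
Proof.
move=> s_uniq sx; apply: ds_eqP => k.
have [p pE] := ds_proj_exists k; rewrite -[RHS]pE linear_sum /=.
have [ks|ks] := boolP ((k : {classic J}) \in s).
  rewrite (bigD1_seq (k : {classic J})) //= pE ds_incl_id big1 ?addr0 //.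
  by move=> j /eqP jk; rewrite pE ds_incl_neq // => kj; apply: jk.
have -> : x k = 0 by apply: contrapT => /sx; exact/negP.
rewrite big_seq big1 // => j js; rewrite pE ds_incl_neq // => kj.
by rewrite kj js in ks.
Qed.

Lemma ds_ext M (f g : {linear S -> M}) :
  (forall j t, f (ds_incl j t) = g (ds_incl j t)) -> f =1 g.
Proof.
move=> fg x; have [s [s_uniq sx]] := ds_support x.
by rewrite (ds_sum s_uniq sx) !linear_sum; apply: eq_bigr => j _; exact: fg.
Qed.

Lemma ds_lift M (f : J -> {linear T -> M}) : exists F : {linear S -> M},
  forall j t, F (ds_incl j t) = f j t.
Proof.
pose F (x : S) : M := \sum_(j \in [set: {classic J}]) f j (x j).
have FE (x : S) (s : seq {classic J}) : uniq s ->
    (forall j : {classic J}, x j <> 0 -> j \in s) ->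
    F x = \sum_(j <- s) f j (x j).
  move=> s_uniq sx; rewrite /F (@fsbigE _ _ _ _ _ s) //= => [|j _ js].
    by apply: eq_bigl => j; rewrite in_setT.
  by rewrite (_ : x j = 0) ?linear0 //; apply: contrapT => /sx; exact/negP.
have [G GE] : exists G : {linear S -> M}, forall x, G x = F x.
  apply: linear_exists => a u v.
  (* Both sums are computed along a list that contains the two supports *)
  have [s [s_uniq su]] := ds_support u; have [t [t_uniq tv]] := ds_support v.
  have r_uniq : uniq (undup (s ++ t)) by exact: undup_uniq.
  rewrite !(FE _ _ r_uniq) => [|j|j|j]; rewrite ?mem_undup ?mem_cat.
  - rewrite scaler_sumr -big_split; apply: eq_bigr => j _ /=.
    by rewrite -linearP.
  - by move/tv->; rewrite orbT.
  - by move/su->.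
  - apply: contra_notT; rewrite negb_or => /andP[js jt].
    rewrite ds_linE.
    have -> : u j = 0 by apply: contrapT => /su; exact/negP.
    have -> : v j = 0 by apply: contrapT => /tv; exact/negP.
    by rewrite scaler0 addr0.
exists G => j t; rewrite GE (FE _ [:: j : {classic J}]) // => [|k].
  by rewrite big_seq1 ds_incl_id.
by rewrite inE; apply: contra_notT => /eqP kj; exact: ds_incl_neq.
Qed.

Lemma ds_linear_eq0 M (F : {linear S -> M}) (x : S) :
  (forall j, F (ds_incl j (x j)) = 0) -> F x = 0.
Proof.
move=> Fx0; have [s [s_uniq sx]] := ds_support x.
by rewrite (ds_sum s_uniq sx) linear_sum big1.
Qed.

End DirectSum.

Section DirectSumMap.
Variables (R : pzRingType) (T U : lmodType R) (J : Type).
Variable f : {linear T -> U}.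

Lemma ds_map_exists : exists F : {linear direct_sum T J -> direct_sum U J},
  forall x j, F x j = f (x j).
Proof.
have /choice[F FE] : forall x : direct_sum T J,
    exists y : direct_sum U J, forall j, y j = f (x j).
  move=> x; apply: ds_build; case: x => x /= /asboolP; apply: sub_finite_set.
  by move=> j /= fxj xj; apply: fxj; rewrite xj linear0.
have [G GE] : exists G : {linear direct_sum T J -> direct_sum U J},
    forall x, G x = F x.
  apply: linear_exists => a u v; apply: ds_eqP => j.
  by rewrite ds_linE !FE -linearP.
by exists G => x j; rewrite GE.
Qed.

(** Preimages are chosen to vanish where y does, so that they form a finitely
    supported family. *)
Lemma ds_map_lift (y : direct_sum U J) : (forall j, exists t, f t = y j) ->
  exists x : direct_sum T J, forall j, f (x j) = y j.
Proof.
move=> y_im.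
have /choice[g gP] : forall j, exists t, f t = y j /\ (y j = 0 -> t = 0).
  move=> j; have [yj0|yj0] := pselect (y j = 0).
    by exists 0; rewrite linear0.
  by have [t ft] := y_im j; exists t.
have [x xE] : exists x : direct_sum T J, forall j, x j = g j.
  apply: ds_build; case: y {y_im} gP => y /= /asboolP y_fin gP.
  apply: sub_finite_set y_fin => j /= gj yj; apply: gj.
  by have [_ ->] := gP j.
by exists x => j; rewrite xE; have [] := gP j.
Qed.

End DirectSumMap.

(** * Factorizations and projective lifting *)

Section Factor.
Variable R : pzRingType.
Implicit Types A B C M P X Y : lmodType R.

Lemma factor_through_surj A B C (p : {linear A -> B}) (g : {linear A -> C}) :
  is_surjective p -> (forall x, p x = 0 -> g x = 0) ->
  exists u : {linear B -> C}, forall x, u (p x) = g x.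
Proof.
move=> /choice[s ps] g0.
have gE x y : p x = p y -> g x = g y.
  move=> pxy; apply/subr0_eq; rewrite -linearB; apply: g0.
  by rewrite linearB /= pxy subrr.
have [u uE] : exists u : {linear B -> C}, forall y, u y = g (s y).
  apply: linear_exists => a y z; rewrite -linearP; apply: gE.
  by rewrite linearP /= !ps.
by exists u => x; rewrite uE; apply: gE.
Qed.

Lemma factor_through_inj A B C (i : {linear A -> B}) (g : {linear C -> B}) :
  injective i -> (forall x, exists y, i y = g x) ->
  exists u : {linear C -> A}, forall x, i (u x) = g x.
Proof.
move=> i_inj /choice[s sE].
have [u uE] : exists u : {linear C -> A}, forall x, u x = s x.
  apply: linear_exists => a x y; apply: i_inj.
  by rewrite linearP /= !sE linearP.
by exists u => x; rewrite uE.
Qed.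

Lemma injective_ker0 A B (i : {linear A -> B}) :
  (forall x, i x = 0 -> x = 0) -> injective i.
Proof.
by move=> i0 x y ixy; apply/subr0_eq/i0; rewrite linearB /= ixy subrr.
Qed.

(** Projectivity is only given against surjections; projecting the pullback of
    d and f onto P is a surjection, and a section of it yields the lift. *)
Lemma projective_lift P X Y (d : {linear X -> Y}) (f : {linear P -> Y}) :
  projective P -> (forall x, exists y, d y = f x) ->
  exists h : {linear P -> X}, forall x, d (h x) = f x.
Proof.
move=> P_proj f_im.
pose m : {linear (X * P)%type -> Y} := (d \o fst) \- (f \o snd).
have [K [i [_ iP]]] := kernel_exists m.
have [|h hE] := P_proj K P (snd \o i) idfun.
  move=> x; have [y dy] := f_im x.
  have /iP[k ik] : m (y, x) = 0 by rewrite /= dy subrr.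
  by exists k; rewrite /= ik.
exists (fst \o (i \o h)) => x /=.
have /eqP : m (i (h x)) = 0 by apply/iP; exists (h x).
by rewrite /= subr_eq0 => /eqP ->; congr (f _); exact: hE.
Qed.

Lemma zero_module_exists : exists N : lmodType R, zero_module N.
Proof.
have [N [i [i_inj iP]]] := kernel_exists (idfun : {linear R^o -> R^o}).
exists N => x; apply: i_inj; rewrite linear0.
by have := (iP (i x)).2 (ex_intro _ x erefl).
Qed.

(** If f maps ker c onto its whole image then P = ker f + ker c. *)
Lemma superfluous_image0 P X M (c : {linear P -> X}) (f : {linear P -> M}) :
  superfluous [pred x | c x == 0] ->
  (forall x, exists y, c y = 0 /\ f y = f x) -> forall x, f x = 0.
Proof.
move=> c_sup f_im x.
suff : x \in [pred x | f x == 0] by rewrite inE => /eqP.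
apply: c_sup => [|{}x].
  split=> [|a y z]; rewrite !inE ?linear0 // => /eqP fy /eqP fz.
  by rewrite linearP /= fy fz scaler0 addr0.
have [y [cy fy]] := f_im x.
exists (x - y), y; split; rewrite ?inE ?subrK //=; last exact/eqP.
by rewrite linearB /= fy subrr.
Qed.

End Factor.

(** * The class Gen T *)

Section Gen.
Variables (R : pzRingType) (T : lmodType R).
Implicit Types (J : Type) (A M N : lmodType R).

(** A direct summand of T^(J) is also a quotient of it, so Add T may be replaced
    by the direct sums themselves. *)
Lemma in_GenP M :
  in_Gen T M <-> exists J (e : {linear direct_sum T J -> M}), is_surjective e.
Proof.
split=> [[A [[J [N [f f_bij]]] [u u_surj]]]|[J [e e_surj]]].
  have [g gK fK] := f_bij.
  have [e eE] : exists e : {linear direct_sum T J -> M},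
      forall x, e x = u (g x).1.
    apply: linear_exists => a x y.
    have -> : g (a *: x + y) = a *: g x + g y.
      by apply: (bij_inj f_bij); rewrite linearP /= !fK.
    exact: linearP.
  exists J, e => m; have [a ua] := u_surj m.
  by exists (f (a, 0)); rewrite eE gK.
exists (direct_sum T J); split; last by exists e.
have [N N0] := zero_module_exists R.
exists J, N, fst; exists (fun x => (x, 0)) => [[x n]|x] //=.
by rewrite (N0 n).
Qed.

Lemma in_Gen_direct_sum J : in_Gen T (direct_sum T J).
Proof. by apply/in_GenP; exists J, idfun => x; exists x. Qed.

Lemma in_Gen_quotient M N (q : {linear M -> N}) :
  is_surjective q -> in_Gen T M -> in_Gen T N.
Proof.
move=> q_surj /in_GenP[J [e e_surj]]; apply/in_GenP; exists J, (q \o e) => y.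
by have [x <-] := q_surj y; have [z <-] := e_surj x; exists z.
Qed.

Lemma in_Gen_self : in_Gen T T.
Proof.
have [p pE] := @ds_proj_exists R T unit tt.
apply: (@in_Gen_quotient _ _ p) (in_Gen_direct_sum unit) => x.
by exists (ds_incl T tt x); rewrite pE ds_incl_id.
Qed.

(** Take J = Hom(T, M) and the evaluation map: every u : T -> M is then the
    restriction of e to a coordinate, and any other map T^(J') -> M factors
    through e, which gives surjectivity. *)
Lemma Gen_precover M : in_Gen T M ->
  exists J (e : {linear direct_sum T J -> M}), is_surjective e /\
    forall u : {linear T -> M}, exists w : {linear T -> direct_sum T J},
      forall x, e (w x) = u x.
Proof.
move=> /in_GenP[J [e e_surj]].
have [F FE] := @ds_lift R T {linear T -> M} M id.
exists {linear T -> M}, F; split=> [y|u]; last first.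
  by exists (ds_incl T u) => x; rewrite FE.
have [G GE] := ds_lift
  (fun j => ds_incl T (e \o @ds_incl R T J j : {linear T -> M})).
have FG : F \o G =1 e by apply: (ds_ext (f := F \o G)) => j t /=; rewrite GE FE.
by have [x <-] := e_surj y; exists (G x); rewrite -FG.
Qed.

End Gen.

(** * Projective resolutions *)

(** The invariant G is what each step needs in order to be continued. *)
Lemma dependent_choice_nat (X : nat -> Type) (G : forall n, X n -> Prop)
    (r : forall n, X n -> X n.+1 -> Prop) (x0 : X 0%N) :
  G 0%N x0 -> (forall n x, G n x -> exists y, r n x y /\ G n.+1 y) ->
  exists f : forall n, X n, f 0%N = x0 /\ forall n, r n (f n) (f n.+1).
Proof.
move=> G0 step.
pose S n := {x : X n | G n x}.
pose next n (s : S n) : S n.+1 :=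
  let c := cid (step n (sval s) (svalP s)) in
  exist _ (sval c) (proj2 (svalP c)).
pose seq := fix seq n : S n :=
  if n is m.+1 then next m (seq m) else exist _ x0 G0.
exists (fun n => sval (seq n)); split=> // n /=.
by case: cid => y /= [].
Qed.

Section Resolutions.
Variable R : pzRingType.
Implicit Types A M : lmodType R.

Lemma res_diff_diff A (P : projective_resolution A) n x :
  res_diff P n (res_diff P n.+1 x) = 0.
Proof. by apply/(res_exact (p := P)); exists x. Qed.

Lemma res_aug_diff A (P : projective_resolution A) x :
  res_aug P (res_diff P 0 x) = 0.
Proof. by apply/(res_exact_aug (p := P)); exists x. Qed.

Lemma comparison A (P Q : projective_resolution A) :
  exists phi : forall n, {linear res_obj P n -> res_obj Q n},
    (forall x, res_aug Q (phi 0%N x) = res_aug P x) /\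
    (forall n x, res_diff Q n (phi n.+1 x) = phi n (res_diff P n x)).
Proof.
(* The invariant: a sends boundaries to boundaries *)
have [phi0 phi0E] := projective_lift (@res_projective _ _ P 0)
  (fun x => res_aug_surj Q (res_aug P x)).
pose G n (a : {linear res_obj P n -> res_obj Q n}) :=
  forall x, exists y, res_diff Q n y = a (res_diff P n x).
pose r n (a : {linear res_obj P n -> res_obj Q n})
    (b : {linear res_obj P n.+1 -> res_obj Q n.+1}) :=
  forall x, res_diff Q n (b x) = a (res_diff P n x).
have [|n a aG|phi [phiE0 phiE]] := @dependent_choice_nat _ G r phi0.
- by move=> x; apply/(res_exact_aug (p := Q)); rewrite phi0E res_aug_diff.
- have [b bE] := @projective_lift _ _ _ _ (res_diff Q n) (a \o res_diff P n)
    (@res_projective _ _ P n.+1) aG.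
  exists b; split=> // x; apply/(res_exact (p := Q)).
  by rewrite bE /= res_diff_diff linear0.
by exists phi; split=> [x|n x]; [rewrite phiE0 phi0E | exact: phiE].
Qed.

Lemma null_homotopy A (Q : projective_resolution A)
    (e : forall n, {linear res_obj Q n -> res_obj Q n}) :
  (forall x, res_aug Q (e 0%N x) = 0) ->
  (forall n x, res_diff Q n (e n.+1 x) = e n (res_diff Q n x)) ->
  exists h : forall n, {linear res_obj Q n -> res_obj Q n.+1},
    forall n x, res_diff Q n.+1 (h n.+1 x) = e n.+1 x - h n (res_diff Q n x).
Proof.
move=> e_aug eE.
(* The invariant: e_n - d h_n vanishes on boundaries, which is what puts the
   values of e_(n+1) - h_n d in ker d_n = im d_(n+1). *)
have [h0 h0E] := @projective_lift _ _ _ _ (res_diff Q 0) (e 0%N)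
  (@res_projective _ _ Q 0) (fun x => (res_exact_aug (p := Q) _).1 (e_aug x)).
pose G n (h : {linear res_obj Q n -> res_obj Q n.+1}) :=
  forall x, res_diff Q n (h (res_diff Q n x)) = e n (res_diff Q n x).
pose r n (h : {linear res_obj Q n -> res_obj Q n.+1})
    (k : {linear res_obj Q n.+1 -> res_obj Q n.+2}) :=
  forall x, res_diff Q n.+1 (k x) = e n.+1 x - h (res_diff Q n x).
have [|n h hG|h [_ hE]] := @dependent_choice_nat _ G r h0.
- by move=> x; rewrite h0E.
- have [|k kE] := @projective_lift _ _ _ _ (res_diff Q n.+1)
    (e n.+1 \- (h \o res_diff Q n)) (@res_projective _ _ Q n.+1).
    move=> x; apply/(res_exact (p := Q)).
    by rewrite linearB /= eE hG subrr.
  exists k; split=> // x.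
  by rewrite kE /= res_diff_diff linear0 subr0.
by exists h; exact: hE.
Qed.

(** A cocycle on Q is transported to P and back by chain maps whose composite
    is homotopic to the identity, so it changes by a coboundary only. *)
Lemma Ext_eq0_resolution A (P : projective_resolution A) M n :
  (forall f : {linear res_obj P n.+1 -> M}, cocycle f -> coboundary f) ->
  Ext_eq0 n.+1 A M.
Proof.
move=> P0 Q f f_cocycle.
have [phi [phi_aug phiE]] := comparison P Q.
have [psi [psi_aug psiE]] := comparison Q P.
pose e n : {linear res_obj Q n -> res_obj Q n} := idfun \- (phi n \o psi n).
have [|k x|h hE] := @null_homotopy _ Q e.
- by move=> x; rewrite /e linearB /= phi_aug psi_aug subrr.
- by rewrite /e linearB /= phiE psiE.
have [x|g gE] := P0 (f \o phi n.+1).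
  by rewrite /= -phiE; exact: f_cocycle.
exists ((g \o psi n) \+ (f \o h n)) => x /=.
have := f_cocycle (h n.+1 x); rewrite hE /e !linearB /= => /subr0_eq.
by rewrite [f (phi _ _)]gE psiE => <-; rewrite addrC subrK.
Qed.

(** The two lowest terms are left unconstrained, so that a resolution can be
    minimal in this sense while starting with a prescribed presentation. *)
Definition minimal A (Q : projective_resolution A) : Prop :=
  forall n, superfluous [pred x | res_diff Q n.+1 x == 0].

(** State of the iteration that builds a resolution: the next differential
    depends on the last one only. *)
Record proj_arrow := ProjArrow {
  arr_src : lmodType R; arr_tgt : lmodType R;
  arr_map : {linear arr_src -> arr_tgt};
  arr_proj : projective arr_src
}.

Record kernel_cover (a : proj_arrow) := KernelCover {
  cov_src : lmodType R;
  cov_map : {linear cov_src -> arr_src a};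
  cov_proj : projective cov_src;
  cov_exact : exact_at cov_map (arr_map a);
  cov_superfluous : superfluous [pred x | cov_map x == 0]
}.

Lemma kernel_cover_exists (hR : left_perfect R) (a : proj_arrow) :
  inhabited (kernel_cover a).
Proof.
have [K [i [i_inj iP]]] := kernel_exists (arr_map a).
have [P [q [P_proj q_surj q_sup]]] := hR K.
constructor; apply: (@KernelCover a P (i \o q)) => // [y|N N_sub N_sum].
  split=> [/iP[k <-]|[x <-]]; last by apply/iP; exists (q x).
  by have [x <-] := q_surj k; exists x.
apply: q_sup => // x; have [y [z [yN /eqP qz ->]]] := N_sum x.
by exists y, z; split=> //; apply/eqP/i_inj; rewrite linear0.
Qed.

Lemma minimal_resolution (hR : left_perfect R) (A P1 P0 : lmodType R)
    (sigma : {linear P1 -> P0}) : projective_presentation A sigma ->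
  exists Q : projective_resolution A, minimal Q /\
    forall X, in_D (res_diff Q 0) X <-> in_D sigma X.
Proof.
move=> [P1_proj P0_proj [p [p_surj sigma_p]]].
pose cov a : kernel_cover a := inhabited_witness (kernel_cover_exists hR a).
pose next a := ProjArrow (cov_map (cov a)) (@cov_proj _ (cov a)).
pose st n := iter n next (ProjArrow sigma P1_proj).
have st_proj n : projective (arr_tgt (st n)).
  by case: n => //= n; exact: arr_proj.
exists (@ProjectiveResolution R A (fun n => arr_tgt (st n))
  (fun n => arr_map (st n)) p st_proj p_surj sigma_p
  (fun n => @cov_exact _ (cov (st n)))); split=> //= n.
exact: cov_superfluous.
Qed.

(** If d_n is injective then d_(n+1) = 0, so the whole of the term n+2 is a
    superfluous kernel, hence zero; then d_(n+1) is injective in turn. *)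
Lemma minimal_zero A (Q : projective_resolution A) n : minimal Q ->
  (forall x, res_diff Q n x = 0 -> x = 0) ->
  forall k, (n.+1 < k)%N -> zero_module (res_obj Q k).
Proof.
move=> Q_min d_inj.
have step m : (forall x, res_diff Q m x = 0 -> x = 0) ->
    zero_module (res_obj Q m.+2).
  move=> m_inj; pose id2 : {linear res_obj Q m.+2 -> res_obj Q m.+2} := idfun.
  apply: (superfluous_image0 (f := id2) (Q_min m)) => x.
  by exists x; split=> //; apply: m_inj; exact: res_diff_diff.
suff H k : zero_module (res_obj Q (n.+2 + k)).
  by move=> k nk; rewrite -(subnKC nk).
elim: k => [|k IHk]; first by rewrite addn0; exact: step.
rewrite addnS; apply: (step (n.+1 + k)%N) => x _; exact: IHk.
Qed.

End Resolutions.

(** * Vanishing of Ext *)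

Section Ext.
Variable R : pzRingType.
Implicit Types A L M N : lmodType R.

(** The segment Ext^(n+1)(A, N) -> Ext^(n+1)(A, M) -> Ext^(n+2)(A, L) of the
    long exact sequence of 0 -> L -> N -> M -> 0. *)
Lemma Ext_eq0_shift A L N M (i : {linear L -> N}) (e : {linear N -> M}) n :
  injective i -> exact_at i e -> is_surjective e ->
  Ext_eq0 n.+2 A L -> Ext_eq0 n.+1 A N -> Ext_eq0 n.+1 A M.
Proof.
move=> i_inj ie e_surj L0 N0 P f f_cocycle.
have [f' f'E] := projective_lift (@res_projective _ _ P n.+1)
  (fun x => e_surj (f x)).
have [|l lE] := factor_through_inj (g := f' \o res_diff P n.+1) i_inj.
  by move=> x; apply/ie; rewrite /= f'E f_cocycle.
have [x|g gE] := L0 P l.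
  by apply: i_inj; rewrite lE /= res_diff_diff !linear0.
have [x|h hE] := N0 P (f' \- (i \o g)).
  by rewrite /= -gE lE subrr.
exists (e \o h) => x; rewrite /= -hE linearB /= f'E.
by rewrite (_ : e (i _) = 0) ?subr0 //; apply/ie; exists (g x).
Qed.

Lemma Ext_eq0_zero_term A M (P : projective_resolution A) n :
  zero_module (res_obj P n.+1) -> Ext_eq0 n.+1 A M.
Proof.
move=> P0; apply: (Ext_eq0_resolution (P := P)) => f _.
by exists \0 => x; rewrite (P0 x) linear0.
Qed.

Lemma in_D_Ext1 A M (Q : projective_resolution A) :
  (forall x, res_diff Q 0 x = 0 -> x = 0) ->
  in_D (res_diff Q 0) M <-> Ext_eq0 1 A M.
Proof.
move=> d_inj; split=> [M_D|M_ext f].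
  apply: (Ext_eq0_resolution (P := Q)) => f _.
  by have [g gE] := M_D f; exists g.
have [x|g gE] := M_ext Q f; last by exists g.
by rewrite (d_inj _ (res_diff_diff (P := Q) x)) linear0.
Qed.

(** Bongartz's universal extension 0 -> M -> E -> A^(I) -> 0, where I is the set
    of all 1-cocycles h : Q_1 -> M: E is the pushout of the map Q_1^(I) -> M
    with components h along d_0^(I).  Each h extends along d_0 to a map into E,
    so the map Ext^1(A, M) -> Ext^1(A, E) is zero, while Ext^1(A, A^(I)) = 0. *)
Lemma Ext1_orthogonal_embedding A (Q : projective_resolution A) :
  (forall J : Type, Ext_eq0 1 A (direct_sum A J)) ->
  forall M, exists (E : lmodType R) (j : {linear M -> E}),
    injective j /\ Ext_eq0 1 A E.
Proof.
move=> A_ext M.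
pose I := {h : {linear res_obj Q 1 -> M} | cocycle h}.
have [F FE] := ds_lift (fun h : I => sval h).
have [D DE] := ds_map_exists I (res_diff Q 0).
have [a aE] := ds_map_exists I (res_aug Q).
have [m mE] : exists m : {linear direct_sum (res_obj Q 1) I ->
    (M * direct_sum (res_obj Q 0) I)%type}, forall x, m x = (F x, - D x).
  exact: (linear_pair F (-%R \o D)).
have [E [q [q_surj qP]]] := cokernel_exists m.
have [j jE] : exists j : {linear M -> E}, forall y, j y = q (y, 0).
  have [l lE] := linear_pair (idfun : {linear M -> M})
    (\0 : {linear M -> direct_sum (res_obj Q 0) I}).
  by exists (q \o l) => y; rewrite /= lE.
have [k kE] : exists k : {linear direct_sum (res_obj Q 0) I -> E},
    forall y, k y = q (0, y).
  have [l lE] := linear_pair (\0 : {linear direct_sum (res_obj Q 0) I -> M})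
    (idfun : {linear direct_sum (res_obj Q 0) I -> _}).
  by exists (q \o l) => y; rewrite /= lE.
have jF x : j (F x) = k (D x).
  apply/subr0_eq; rewrite jE kE -linearB /=; apply/qP; exists x.
  by rewrite mE; congr (_, _); rewrite ?subr0 ?sub0r.
have qE y z : q (y, z) = j y + k z.
  by rewrite jE kE -linearD; congr (q (_, _)); rewrite ?addr0 ?add0r.
(* A vector of Q_1^(I) killed by d_0 has coordinates in im d_1, where each
   cocycle h vanishes. *)
have j_inj : injective j.
  apply: injective_ker0 => y; rewrite jE => /qP[x]; rewrite mE => -[<-].
  move=> /eqP; rewrite oppr_eq0 => /eqP Dx.
  apply: ds_linear_eq0 => h; rewrite FE.
  have /(res_exact (p := Q))[z <-] : res_diff Q 0 (x h) = 0 by rewrite -DE Dx.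
  exact: (svalP h).
have [v vE] : exists v : {linear E -> direct_sum A I},
    forall z, v (q z) = a z.2.
  apply: (factor_through_surj (g := a \o snd) q_surj) => z /qP[x].
  rewrite mE => <- /=; rewrite linearN /= (_ : a _ = 0) ?oppr0 //.
  by apply: ds_eqP => h; rewrite aE DE res_aug_diff.
have v_ker e : v e = 0 -> exists y, j y = e.
  have [[y z] <-] := q_surj e; rewrite vE /= => az.
  have [|x xE] := @ds_map_lift _ _ _ _ (res_diff Q 0) z.
    by move=> h; apply/(res_exact_aug (p := Q)); rewrite -aE az.
  exists (y + F x); rewrite qE linearD jF; congr (_ + k _).
  by apply: ds_eqP => h; rewrite DE xE.
exists E, j; split=> //; apply: (Ext_eq0_resolution (P := Q)) => g g_cocycle.
have [x|u uE] := A_ext I Q (v \o g); first by rewrite /= g_cocycle linear0.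
have [|u' u'E] := @projective_lift _ _ _ _ a u (@res_projective _ _ Q 0).
  move=> x; have [|z zE] := @ds_map_lift _ _ _ _ (res_aug Q) (u x).
    by move=> h; exact: res_aug_surj.
  by exists z; apply: ds_eqP => h; rewrite aE zE.
(* g minus a coboundary has values in M, and is then the cocycle with index h *)
have [|c cE] := factor_through_inj
  (g := g \- (k \o (u' \o res_diff Q 0))) j_inj.
  move=> x; apply: v_ker; rewrite linearB /= kE vE /= u'E.
  by rewrite -uE /= subrr.
have c_cocycle : cocycle c.
  move=> x; apply: j_inj.
  by rewrite cE /= res_diff_diff g_cocycle !linear0 addr0.
pose h : I := exist _ c c_cocycle.
exists (k \o (ds_incl _ h \+ u')) => x /=.
have <- : D (ds_incl _ h x) = ds_incl _ h (res_diff Q 0 x).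
  apply: ds_eqP => l; rewrite DE; have [->|lh] := pselect (l = h).
    by rewrite !ds_incl_id.
  by rewrite !ds_incl_neq ?linear0.
by rewrite linearD -jF FE cE /= subrK.
Qed.

End Ext.

(** * Silting modules *)

Section Silting.
Variables (R : pzRingType) (T : lmodType R) (Q : projective_resolution T).
Hypothesis Gen_D : forall M, in_Gen T M <-> in_D (res_diff Q 0) M.
Implicit Types L M N : lmodType R.

(** The kernel L of the precover e is in D_(d_0): a map f : Q_1 -> L extends to
    g : Q_0 -> T^(J), and e g induces a map T -> M; correcting g by a lift of
    that map along e brings its values into L. *)
Lemma Gen_resolve M : in_Gen T M ->
  exists J L (i : {linear L -> direct_sum T J})
      (e : {linear direct_sum T J -> M}),
    [/\ injective i, exact_at i e, is_surjective e & in_Gen T L].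
Proof.
move=> M_Gen; have [J [e [e_surj e_lift]]] := Gen_precover M_Gen.
have [L [i [i_inj ie]]] := kernel_exists e.
exists J, L, i, e; split=> //; apply/Gen_D => f.
have [g gE] := (Gen_D _).1 (in_Gen_direct_sum T J) (i \o f).
have [|u uE] := factor_through_surj (g := e \o g) (res_aug_surj Q).
  move=> x /(res_exact_aug (p := Q))[y <-] /=; rewrite gE.
  by apply/ie; exists (f y).
have [w wE] := e_lift u.
have [|h hE] := factor_through_inj (g := g \- (w \o res_aug Q)) i_inj.
  by move=> x; apply/ie; rewrite linearB /= wE uE subrr.
exists h => x; apply: i_inj.
by rewrite hE /= res_aug_diff linear0 subr0 gE.
Qed.

(** Dimension shifting along the resolutions by sums of copies of T of the
    previous lemma raises the degree until it exceeds pd T. *)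
Lemma Ext_Gen_eq0 : finite_projdim T ->
  (forall (J : Type) i, (1 <= i)%N -> Ext_eq0 i T (direct_sum T J)) ->
  forall M i, in_Gen T M -> Ext_eq0 i.+1 T M.
Proof.
move=> [n [P P0]] T_ext M i M_Gen.
(* Descending induction on i; d bounds its distance to pd T *)
have [d] : exists d, (n < i.+1 + d)%N.
  by exists n.+1; rewrite addnS ltnS leq_addl.
elim: d i M M_Gen => [|d IHd] i M M_Gen n_lt.
  by rewrite addn0 in n_lt; apply: (Ext_eq0_zero_term (P := P)); exact: P0.
have [J [L [k [e [k_inj ke e_surj L_Gen]]]]] := Gen_resolve M_Gen.
apply: (Ext_eq0_shift k_inj ke e_surj); last exact: T_ext.
by apply: IHd => //; rewrite addSnnS.
Qed.

(** A nonzero f : Q_2 -> T would induce a 2-cocycle with values in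
    M = T / f(ker d_1), a module of Gen T, whose class in Ext^2(T, M) is zero.
    Since M is in D_(d_0), all maps Q_1 -> M factor through d_0, so
    2-coboundaries with values in M vanish.  Hence f(Q_2) = f(ker d_1), which
    contradicts the superfluity of ker d_1. *)
Lemma resolution_term2_zero : sincere T -> minimal Q ->
  (forall M, in_Gen T M -> Ext_eq0 2 T M) -> zero_module (res_obj Q 2).
Proof.
move=> T_sincere Q_min Ext2; apply: contrapT => Q2_neq0.
have [f [x0 fx0]] := T_sincere _ (@res_projective _ _ Q 2) Q2_neq0.
apply: fx0; apply: superfluous_image0 (Q_min 0%N) _ _ => x.
have [K [i [_ iP]]] := kernel_exists (res_diff Q 1).
have [M [q [q_surj qP]]] := cokernel_exists (f \o i).
have M_Gen : in_Gen T M := in_Gen_quotient q_surj (in_Gen_self T).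
have [y|g gE] := Ext2 M M_Gen Q (q \o f).
  have [k ik] := (iP _).1 (res_diff_diff (P := Q) y).
  by apply/qP; exists k; rewrite -ik.
have [h hE] := (Gen_D M).1 M_Gen g.
have /qP[k fk] : q (f x) = 0.
  by rewrite [LHS]gE -hE res_diff_diff linear0.
by exists (i k); split=> //; apply/iP; exists k.
Qed.

End Silting.

Theorem theorem4p2 (R : pzRingType) (T : lmodType R)
    (hR : perfect R) (hsincere : sincere T) (hsilting : silting T)
    (hpd : finite_projdim T) :
  tilting T <->
  (forall (J : Type) (i : nat), (1 <= i)%N -> Ext_eq0 i T (direct_sum T J)).
Proof.
have [P1 [P0 [sigma [sigma_pres sigma_D]]]] := hsilting.
have [Q [Q_min QD]] := minimal_resolution hR.1 sigma_pres.
have Gen_D M : in_Gen T M <-> in_D (res_diff Q 0) M.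
  by apply: iff_trans (sigma_D M) _; apply: iff_sym.
split=> [T_tilt | T_ext M]; last first.
  have Ext_Gen := Ext_Gen_eq0 Gen_D hpd T_ext.
  have Q2_zero : zero_module (res_obj Q 2).
    by apply: (resolution_term2_zero Gen_D) => // M'; exact: Ext_Gen.
  apply: iff_trans (Gen_D M) _; apply: in_D_Ext1 => x.
  by move=> /(res_exact (p := Q))[y <-]; rewrite (Q2_zero y) linear0.
have T_ext1 J : Ext_eq0 1 T (direct_sum T J).
  by apply/T_tilt; exact: in_Gen_direct_sum.
have [E [j [j_inj E_ext]]] := Ext1_orthogonal_embedding Q T_ext1 (res_obj Q 1).
have [g gE] := (Gen_D E).1 ((T_tilt E).2 E_ext) j.
have d_inj x : res_diff Q 0 x = 0 -> x = 0.
  by move=> dx; apply: j_inj; rewrite -gE dx !linear0.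
move=> J [//|[|i]] _; first exact: T_ext1.
by apply: (Ext_eq0_zero_term (P := Q)); apply: (minimal_zero (n := 0)).
Qed.
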